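(* Let $(G,B)$ be a connected finite graph with boundary, $|B|\ge2$, equipped with the unit weight, and let $V(G)$ be its vertex set. Then its second Steklov eigenvalue satisfies $$\sigma_2\ge 2e(G)\left(1-\cos\frac{\pi}{|V(G)|}\right)\ge 2v(G)\left(1-\cos\frac{\pi}{|V(G)|}\right),$$ where $e(G)$ is the edge connectivity of $G$ and $v(G)$ is the vertex connectivity of $G$, that is, the least number of edges, respectively vertices, of $G$ that must be deleted to make $G$ disconnected.
   Context: All graphs are finite and simple, and $G$ is connected, with vertex set $V=V(G)$ and edge set $E$. The unit weight means that vertex measure $m\equiv1$ on $V$ and edge weight $w\equiv1$ on $E$ are used; $w_{xy}=1$ if $\{x,y\}\in E$ and $w_{xy}=0$ otherwise. Graph with boundary: $(G,B)$ is a graph together with a nonempty set $B\subset V$ (the boundary) such that no two vertices of $B$ are adjacent and every vertex of $B$ is adjacent to some vertex of $\Omega:=V\setminus B$ (the interior). Laplacian: for $u\in\mathbb{R}^V$, $\Delta u(x)=\sum_{y\in V}(u(y)-u(x))w_{xy}$. Steklov eigenvalues: for $f\in\mathbb{R}^B$ let $u_f\in\mathbb{R}^V$ be the unique function with $u_f=f$ on $B$ and $\Delta u_f=0$ on $\Omega$. The Dirichlet-to-Neumann map $\Lambda:\mathbb{R}^B\to\mathbb{R}^B$ is $\Lambda f(x)=\sum_{y\in V}(u_f(x)-u_f(y))w_{xy}$ for $x\in B$. It is nonnegative and self-adjoint for $\langle f,g\rangle_B=\sum_{x\in B}f(x)g(x)$; its eigenvalues, counted with multiplicity, are $0=\sigma_1<\sigma_2\le\cdots\le\sigma_{|B|}$.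 *)

(* Defs.v *)
From HB Require Import structures.
From mathcomp Require Import all_boot all_order all_algebra.
From mathcomp Require Import boolp classical_sets reals trigo.

Set Implicit Arguments.
Unset Strict Implicit.
Unset Printing Implicit Defensive.

Import Order.TTheory GRing.Theory Num.Theory.
Local Open Scope ring_scope.

Definition simple_graph (V : finType) (adj : rel V) : Prop :=
  symmetric adj /\ irreflexive adj.

(* The graph on no vertex or on one vertex counts as connected. *)
Definition connected_graph (V : finType) (adj : rel V) : bool :=
  [forall x, forall y, connect adj x y].

Definition graph_with_boundary (V : finType) (adj : rel V) (B : {set V}) : Prop :=
  [/\ B != finset.set0,
      forall x y, x \in B -> y \in B -> ~~ adj x y
    & forall x, x \in B -> exists2 y, y \notin B & adj x y].

Section Connectivity.

Variables (V : finType) (adj : rel V).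

Definition edges : {set {set V}} :=
  [set F : {set V} | [exists x, exists y, adj x y && (F == [set x; y]%SET)]]%SET.

Definition del_edges (F : {set {set V}}) : rel V :=
  fun x y => adj x y && ([set x; y]%SET \notin F).

Definition del_vertices (S : {set V}) : rel {x : V | x \notin S} :=
  fun x y => adj (val x) (val y).

(* The default value of the minimum only matters when nothing can be
   disconnected: a single vertex for edges; a complete graph for vertices, where
   it gives the usual convention #|V| - 1. Otherwise it is an upper bound of
   the minimum, since a disconnecting set consists of at most #|edges| edges,
   respectively at most #|V| - 2 vertices. *)
Definition edge_connectivity : nat :=
  \big[minn/#|edges|]_(F : {set {set V}} |
      (F \subset edges) && ~~ connected_graph (del_edges F)) #|F|.

Definition vertex_connectivity : nat :=
  \big[minn/#|V|.-1]_(S : {set V} | ~~ connected_graph (@del_vertices S)) #|S|.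

End Connectivity.

Section Steklov.

Variables (R : realType) (V : finType) (adj : rel V) (B : {set V}).

Definition weight (x y : V) : R := (adj x y)%:R.

Definition laplacian (u : {ffun V -> R}) (x : V) : R :=
  \sum_(y : V) (u y - u x) * weight x y.

Definition boundary : finType := {x : V | x \in B}.

(* [R^o] is [R] as a vector space over itself. *)
Definition boundary_fun := {ffun boundary -> R^o}.

Definition is_harmonic_extension (f : boundary_fun) (u : {ffun V -> R}) : Prop :=
  (forall x : boundary, u (val x) = f x) /\
  (forall x : V, x \notin B -> laplacian u x = 0).

(* Description operator: the extension exists and is unique when the graph is
   connected and [B] is nonempty. *)
Definition harmonic_extension (f : boundary_fun) : {ffun V -> R} :=
  xget 0 (is_harmonic_extension f).

Definition dtn_map (f : boundary_fun) : boundary_fun :=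
  [ffun x : boundary => \sum_(y : V)
     (harmonic_extension f (val x) - harmonic_extension f y) * weight (val x) y].

(* [linfun] packages [dtn_map], which is linear when the graph is connected and
   [B] is nonempty. *)
Definition dtn_operator : 'End(boundary_fun) := linfun dtn_map.

(* The nondecreasing list of the eigenvalues, each repeated according to the
   dimension of its eigenspace; these conditions determine [s]. *)
Definition is_steklov_spectrum (s : seq R) : Prop :=
  sorted <=%R s /\
  forall a : R, count_mem a s = \dim (passmx.leigenspace dtn_operator a).

Definition steklov_spectrum : seq R := xget [::] is_steklov_spectrum.

(* The k-th Steklov eigenvalue, numbered from k = 1. *)
Definition steklov_eigenvalue (k : nat) : R := steklov_spectrum`_k.-1.

End Steklov.

(* Main.v *)
(* An eigenfunction f for a nonzero eigenvalue sums to 0 on B, and its eigenvalue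
   is the Dirichlet energy of its harmonic extension u divided by |f|^2. Centering
   u on V can only increase the norm, so it suffices to bound the energy of a
   function of mean 0 on V. Listing the vertices by increasing u, the edges
   crossing each cut of this order number at least e(G), so the energy is at least
   e(G) times that of the sorted values on a path with |V| vertices, whose
   spectral gap is 2 (1 - cos (pi / |V|)). *)
From HB Require Import structures.
Require Import Defs.
From mathcomp Require Import all_boot all_order all_algebra.
From mathcomp Require Import reals trigo.
From mathcomp Require Import complex polyrcf.
From mathcomp Require Import ring lra.
From mathcomp Require classical_sets.
Import Order.TTheory GRing.Theory Num.Theory.
Set Implicit Arguments.
Unset Strict Implicit.
Unset Printing Implicit Defensive.
Local Open Scope ring_scope.

(** * Spectral theory over a real closed field *)

(** Over [R[i]] the matrix is hermitian, hence unitarily diagonalizable with a real diagonal [D].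
    Some entry of [D] is nonzero, and it is a root of the characteristic polynomial already over
    [R]. *)
Lemma symmetric_nonzero_eigenvalue (R : rcfType) n (A : 'M[R]_n) :
  A^T = A -> A != 0 -> exists2 a : R, a != 0 & eigenvalue A a.
Proof.
move=> symA A0; pose C : numClosedFieldType := R[i]%C.
pose AC := map_mx (real_complex R) A : 'M[C]_n.
have hermA : AC \is hermsymmx.
  apply: realsym_hermsym.
    apply/is_hermitianmxP; rewrite expr0 scale1r map_mx_id //.
    by rewrite /AC map_trmx symA.
  by apply/mxOverP => i j; rewrite mxE complex_real.
have /orthomx_spectralP := hermitian_normalmx hermA.
set P := spectralmx AC; set D := spectral_diag AC => AE.
have Pu : P \in unitmx by exact: spectral_unit.
have D0 : D != 0.
  apply: contraNneq A0 => D0; rewrite -(map_mx_eq0 (real_complex R)).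
  by rewrite [map_mx _ _]AE D0 raddf0 mulmx0 mul0mx.
have [j Dj] : exists j, D 0 j != 0.
  apply/existsP; apply: contraNT D0; rewrite negb_exists => /forallP D0.
  by apply/eqP/rowP => j; rewrite mxE; apply/eqP; rewrite -[_ == _]negbK.
have := hermitian_spectral_diag_real hermA.
move=> /mxOverP/(_ 0 j)/complex_realP[a Da].
exists a.
  by apply: contraNneq Dj => a0; rewrite Da a0.
suff : eigenvalue AC (D 0 j).
  by rewrite !eigenvalue_root_char -map_char_poly Da fmorph_root.
apply/eigenvalueP; exists (row j P).
  rewrite -row_mul AE !mulmxA mulmxV // mul1mx row_mul row_diag_mx.
  by rewrite -scalemxAl -rowE.
apply: contraTneq (Pu) => /(congr1 (mulmx^~ (invmx P))).
rewrite -row_mul mulmxV // mul0mx => /rowP/(_ j) /eqP.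
by rewrite !mxE eqxx oner_eq0.
Qed.

Lemma leigenspaceP (F : fieldType) (vT : vectType F) (L : 'End(vT)) a v :
  reflect (L v = a *: v) (v \in passmx.leigenspace L a).
Proof.
by rewrite memv_ker add_lfunE opp_lfunE scale_lfunE id_lfunE subr_eq0; apply: eqP.
Qed.

(** The candidates are the finitely many roots of the characteristic polynomial. Existence gives
    meaning to the description in [steklov_spectrum]. *)
Lemma eigenvalue_list_exists (R : rcfType) (vT : vectType R) (L : 'End(vT)) :
  exists s : seq R, sorted <=%R s /\
    forall a, count_mem a s = \dim (passmx.leigenspace L a).
Proof.
pose e := vbasis {:vT}; have eb : basis_of {:vT} e := vbasisP _.
pose p := char_poly (passmx.mxof e e L).
have p0 : p != 0 by rewrite monic_neq0 // char_poly_monic.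
pose t := rootsR p.
have tP a : passmx.leigenspace L a != 0%VS -> a \in t.
  rewrite (passmx.leigenspaceE eb) passmx.vsof_eq0 //.
  rewrite -/(eigenvalue _ a) eigenvalue_root_char -/p => ra.
  by rewrite -(roots_on_rootsR p0) inE ra.
pose d a := \dim (passmx.leigenspace L a).
exists (sort <=%R (flatten [seq nseq (d a) a | a <- undup t])); split.
  exact/sort_sorted/le_total.
move=> a; rewrite count_sort count_flatten -map_comp.
have -> : [seq (count_mem a \o (fun a => nseq (d a) a)) b | b <- undup t] =
          [seq ((b == a) * d b)%N | b <- undup t].
  by apply: eq_map => b /=; rewrite count_nseq.
have [at_|at_] := boolP (a \in t); last first.
  transitivity 0%N; last first.
    apply/esym/eqP; rewrite dimv_eq0; apply: contraNT at_; exact: tP.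
  rewrite sumnE big_map big1_seq // => b /andP[_]; rewrite mem_undup => bt.
  by case: eqP bt at_ => // -> ->.
rewrite sumnE big_map (bigD1_seq a) ?undup_uniq ?mem_undup //= eqxx mul1n.
rewrite big1 ?addn0 // => b /negbTE ->; exact: mul0n.
Qed.

Lemma selfadjoint_nonzero_eigenvalue (R : rcfType) (I : finType)
    (L : 'End({ffun I -> R^o})) :
    (forall f g : {ffun I -> R^o}, \sum_i L f i * g i = \sum_i f i * L g i) -> L != 0 ->
  exists2 a : R, a != 0 & exists2 f, f != 0 & L f = a *: f.
Proof.
move=> saL L0; pose e (x : I) : {ffun I -> R^o} := [ffun y => (y == x)%:R].
have sum_e (g : I -> R) x : \sum_i g i * e x i = g x.
  rewrite (bigD1 x) //= ffunE eqxx mulr1 big1 ?addr0 // => i /negbTE ix.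
  by rewrite ffunE ix mulr0.
have decomp (f : {ffun I -> R^o}) : f = \sum_x f x *: e x :> {ffun I -> R^o}.
  apply/ffunP => y; rewrite sum_ffunE -[LHS](sum_e f y); apply: eq_bigr => x _.
  by rewrite !ffunE eq_sym.
have Le x y : L (e x) y = L (e y) x.
  rewrite -(sum_e (L (e x)) y) saL -[RHS](sum_e (L (e y)) x).
  by apply: eq_bigr => i _; rewrite mulrC.
(* Row [i] holds the values of [L] at the [i]-th indicator function, so [v *m A] lists the values of
   [L f] for the function [f] with coordinates [v]. *)
pose A := \matrix_(i, j) L (e (enum_val i)) (enum_val j) : 'M[R]_#|I|.
have [a a0 /eigenvalueP[v vA v0]] : exists2 a : R, a != 0 & eigenvalue A a.
  apply: symmetric_nonzero_eigenvalue.
    by apply/matrixP => i j; rewrite !mxE Le.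
  apply: contraNneq L0 => A0; apply/eqP/lfunP => f; rewrite lfunE /= [f in L f]decomp.
  rewrite linear_sum big1 // => x _; rewrite linearZ /=.
  suff -> : L (e x) = 0 by rewrite scaler0.
  apply/ffunP => y; have /matrixP/(_ (enum_rank x) (enum_rank y)) := A0.
  by rewrite !mxE !enum_rankK ffunE.
pose f : {ffun I -> R^o} := [ffun x => v 0 (enum_rank x)].
exists a => //; exists f.
  apply: contraNneq v0 => f0; apply/eqP/rowP => i.
  by have /ffunP/(_ (enum_val i)) := f0; rewrite !ffunE enum_valK mxE.
apply/ffunP => y; rewrite [f in L f]decomp linear_sum sum_ffunE.
have -> : (a *: f) y = a * v 0 (enum_rank y) by rewrite !ffunE.
have /rowP/(_ (enum_rank y)) := vA; rewrite !mxE => <-.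
rewrite (reindex (@enum_rank I)) /=; last by apply: onW_bij; apply: enum_rank_bij.
by apply: eq_bigr => x _; rewrite linearZ /= !ffunE !mxE !enum_rankK.
Qed.

(** * The spectral gap of the path *)

Lemma sin_pi_div_gt0 (R : realType) n k :
  (0 < k < n)%N -> 0 < sin (k%:R * (pi / n%:R)) :> R.
Proof.
move=> /andP[k0 kn]; have n0 : (0 < n)%N by exact: leq_trans kn.
apply: sin_gt0_pi; rewrite mulr_gt0 ?divr_gt0 ?pi_gt0 ?ltr0n //=.
by rewrite mulrCA gtr_pMr ?pi_gt0 // ltr_pdivrMr ?ltr0n // mul1r ltr_nat.
Qed.

(** The eigenvalue equation of the path for the eigenvalue [2 * (1 - cos t)], as a recurrence. *)
Lemma sin_three_term (R : realType) (t : R) k :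
  sin (k.+2%:R * t) = 2 * cos t * sin (k.+1%:R * t) - sin (k%:R * t).
Proof.
have -> : k.+2%:R * t = k.+1%:R * t + t by rewrite -[k.+2]addn1 natrD; ring.
have -> : k%:R * t = k.+1%:R * t - t by rewrite -[k.+1]addn1 natrD; ring.
rewrite sinD sinB; ring.
Qed.

(* Picone's argument: w is compared with the positive solution sin(k pi / n) of
   the eigenvalue equation on the path, term by term. *)
Lemma dirichlet_path_inequality (R : realType) n (w : nat -> R) :
    w 0%N = 0 -> w n = 0 ->
  2 * (1 - cos (pi / n%:R)) * (\sum_(k < n) w k ^+ 2) <=
    \sum_(k < n) (w k.+1 - w k) ^+ 2.
Proof.
case: n => [|[|n]] w0 wn; first by rewrite !big_ord0 mulr0.
  by rewrite !big_ord1 w0 expr0n mulr0 sqr_ge0.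
set t := pi / _; pose s k := sin (k%:R * t).
have s_gt0 k : (k <= n)%N -> 0 < s k.+1 by move=> kn; apply: sin_pi_div_gt0.
have sS k : s k.+2 = 2 * cos t * s k.+1 - s k by exact: sin_three_term.
have sn : s n.+2 = 0.
  by rewrite /s /t mulrCA divff ?pnatr_eq0 // mulr1 sinpi.
have step k : (k <= n)%N -> (1 - s k / s k.+1) * w k.+1 ^+ 2 +
    ((w k.+2 - w k.+1) ^+ 2 - 2 * (1 - cos t) * w k.+1 ^+ 2) =
    s k.+2 / s k.+1 * w k.+1 ^+ 2 + w k.+2 ^+ 2 - 2 * w k.+1 * w k.+2.
  by move=> /s_gt0 sk; rewrite sS; field; rewrite gt_eqF.
(* From [k] to [k.+1], the right side minus the left side grows by a square divided by
   [s k.+1 * s k.+2]. *)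
have main k : (k <= n)%N -> (1 - s k / s k.+1) * w k.+1 ^+ 2 <=
    \sum_(i < k.+1) ((w i.+1 - w i) ^+ 2 - 2 * (1 - cos t) * w i ^+ 2).
  elim: k => [_|k IH kn].
    rewrite big_ord1 w0 {1}/s mul0r sin0 mul0r !subr0 expr0n /= mulr0 subr0.
    by rewrite mul1r.
  rewrite big_ord_recr /=; apply: le_trans (lerD (IH (ltnW kn)) (lexx _)).
  rewrite step ?(ltnW kn) // -subr_ge0.
  have s1 := s_gt0 _ (ltnW kn); have s2 := s_gt0 _ kn.
  set l := (X in 0 <= X).
  have -> : l = (s k.+2 * w k.+1 - s k.+1 * w k.+2) ^+ 2 / (s k.+1 * s k.+2).
    by rewrite /l; field; rewrite !gt_eqF.
  by rewrite divr_ge0 ?sqr_ge0 // mulr_ge0 // ltW.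
(* [s n.+2 = 0] cannot be a denominator, so the last summand is added separately; there [step] gives
   exactly 0 because [w n.+2 = 0]. *)
rewrite -subr_ge0 mulr_sumr -sumrB big_ord_recr /=.
apply: le_trans (lerD (main _ (leqnn n)) (lexx _)).
by rewrite step // sn wn mul0r mul0r mulr0 expr0n /= addr0 subr0.
Qed.

(* The partial sums of v vanish at both ends of the path, and summation by parts
   pairs them with the increments of v. *)
Lemma neumann_path_inequality (R : realType) n (v : nat -> R) :
    \sum_(k < n) v k = 0 ->
  2 * (1 - cos (pi / n%:R)) * (\sum_(k < n) v k ^+ 2) <=
    \sum_(k < n.-1) (v k.+1 - v k) ^+ 2.
Proof.
case: n => [|n] v0; first by rewrite !big_ord0 mulr0.
set l := 2 * _; have [l0|l0] := leP l 0.
  apply: (@le_trans _ _ 0); last by apply: sumr_ge0 => i _; apply: sqr_ge0.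
  by rewrite mulr_le0_ge0 //; apply: sumr_ge0 => i _; apply: sqr_ge0.
pose w m := \sum_(k < m) v k.
have wS k : w k.+1 = w k + v k by rewrite /w big_ord_recr.
have w0 : w 0%N = 0 by rewrite /w big_ord0.
have := @dirichlet_path_inequality R n.+1 w w0 v0; rewrite -/l.
have -> : \sum_(k < n.+1) (w k.+1 - w k) ^+ 2 = \sum_(k < n.+1) v k ^+ 2.
  by apply: eq_bigr => k _; rewrite wS addrAC subrr add0r.
rewrite big_ord_recl w0 expr0n add0r /=.
set W := \sum_(k < n) _; set Q := \sum_(k < n.+1) _; set D := \sum_(k < n) _ => WQ.
have parts : Q = - \sum_(k < n) w k.+1 * (v k.+1 - v k).
  suff parts m : \sum_(k < m.+1) v k ^+ 2 =
      w m.+1 * v m - \sum_(k < m) w k.+1 * (v k.+1 - v k).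
    by rewrite /Q parts /w v0 mul0r sub0r.
  elim: m => [|m IH]; first by rewrite big_ord1 big_ord0 wS w0; ring.
  by rewrite big_ord_recr IH [in RHS]big_ord_recr /= (wS m.+1); ring.
(* Expand [0 <= (l * w k.+1 + (v k.+1 - v k)) ^+ 2] and sum. Since [l * W <= Q] by the Dirichlet
   inequality for [w], this leaves [l * Q <= D]. *)
have young : 2 * l * Q <= l ^+ 2 * W + D.
  rewrite parts -sumrN mulr_sumr mulr_sumr -big_split /=; apply: ler_sum => k _.
  by rewrite -subr_ge0; have := sqr_ge0 (l * w k.+1 + (v k.+1 - v k)); congr (0 <= _); ring.
have : l ^+ 2 * W <= l * Q by rewrite expr2 -mulrA ler_pM2l.
by move: young; lra.
Qed.

(** * Cuts and the two connectivities *)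

Lemma connect_crosses (T : finType) (e : rel T) (S : {set T}) x y :
    connect e x y -> x \in S -> y \notin S ->
  exists p q, [/\ p \in S, q \notin S & e p q].
Proof.
move=> /connectP[p]; elim: p x => [x _ ->|z p IH x] /=; first by move=> ->.
move=> /andP[exz pz] ylast xS yS.
have [zS|zS] := boolP (z \in S); first exact: IH pz ylast zS yS.
by exists x, z.
Qed.

Section Cuts.

Variables (V : finType) (adj : rel V).

(** Each edge appears once, oriented out of [S], which suits sums over ordered pairs of vertices. *)
Definition cut (S : {set V}) : {set V * V} :=
  [set p | [&& p.1 \in S, p.2 \notin S & adj p.1 p.2]].

Lemma edge_connectivity_le (F : {set {set V}}) : F \subset edges adj ->
  ~~ connected_graph (del_edges adj F) -> (edge_connectivity adj <= #|F|)%N.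
Proof.
move=> Fsub Fdis; rewrite /edge_connectivity -minEnat -leEnat.
by apply: bigmin_le_cond; rewrite Fsub Fdis.
Qed.

Lemma vertex_connectivity_le (S : {set V}) :
    ~~ connected_graph (@del_vertices V adj S) ->
  (vertex_connectivity adj <= #|S|)%N.
Proof.
move=> Sdis; rewrite /vertex_connectivity -minEnat -leEnat.
exact: bigmin_le_cond.
Qed.

Lemma vertex_connectivity_le_pred : (vertex_connectivity adj <= #|V|.-1)%N.
Proof.
rewrite /vertex_connectivity -minEnat -leEnat; exact: bigmin_le_id.
Qed.

(** Deleting the edges underlying the cut separates [a] from [b]. *)
Lemma edge_connectivity_le_cut (S : {set V}) a b :
  a \in S -> b \notin S -> (edge_connectivity adj <= #|cut S|)%N.
Proof.
move=> aS bS; apply: leq_trans (leq_imset_card (fun p => [set p.1; p.2]) _).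
apply: edge_connectivity_le.
  apply/subsetP => _ /imsetP[[x y] + ->]; rewrite inE /= => /and3P[_ _ xy].
  by rewrite inE; apply/existsP; exists x; apply/existsP; exists y; rewrite xy /=.
apply/negP => /forallP/(_ a)/forallP/(_ b)/connect_crosses/(_ aS bS).
case=> p [q [pS qS /andP[pq /negP]]]; apply.
by apply/imsetP; exists (p, q); rewrite // inE pS qS.
Qed.

(** If every vertex of [S] is adjacent to every vertex outside, the cut has [#|S| * #|~: S|] edges,
    at least the default value [#|V|.-1]. Otherwise some nonadjacent pair across the cut can be
    separated by deleting vertices. *)
Lemma vertex_connectivity_le_cut (S : {set V}) a b :
  a \in S -> b \notin S -> (vertex_connectivity adj <= #|cut S|)%N.
Proof.
move=> aS bS.
have [/forall_inP cplt|] :=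
    boolP [forall x in S, [forall y in ~: S, adj x y]].
  apply: leq_trans vertex_connectivity_le_pred _.
  have <- : setX S (~: S) = cut S.
    apply/setP => -[x y]; rewrite !inE /=.
    have [xS|//] := boolP (x \in S); have [//|yS] := boolP (y \in S).
    by have /forall_inP/(_ y) := cplt _ xS; rewrite inE => ->.
  rewrite cardsX -(cardsC S).
  have : (0 < #|S|)%N by apply/card_gt0P; exists a.
  have : (0 < #|~: S|)%N by apply/card_gt0P; exists b; rewrite inE.
  by case: #|S| #|~: S| => [//|m] [//|n] _ _; rewrite addSn mulSn mulnS addnA (addnC n.+1) leq_addr.
move=> /forall_inPn[x xS /forall_inPn[y]]; rewrite inE => yS xy.
(* Deleting the neighbours of x outside S, and the other vertices of S that have
   a neighbour outside S, separates x from y and costs one vertex per cut edge. *)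
pose out z := [pick w | (w \notin S) && adj z w].
pose sel (p : V * V) := if p.1 == x then p.2 else p.1.
pose T := [set sel p | p in cut S].
(* Edges at [x] select vertices outside [S] and the others select vertices of [S] other than [x], so
   [x] survives. Only an edge from [x] to [y] could select [y], and there is none. *)
have xT : x \notin T.
  apply/imsetP => -[[p q]]; rewrite inE /sel /= => /and3P[pS qS _].
  by case: eqVneq => [_ xq|px xp]; [rewrite -xq xS in qS | rewrite xp eqxx in px].
have yT : y \notin T.
  apply/imsetP => -[[p q]]; rewrite inE /sel /= => /and3P[pS qS pq].
  case: eqVneq => [px yq|_ yp]; last by rewrite yp pS in yS.
  by rewrite yq -px pq in xy.
apply: leq_trans (leq_imset_card sel _); apply: vertex_connectivity_le.
apply/negP => /forallP/(_ (Sub x xT))/forallP/(_ (Sub y yT)).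
move=> /(@connect_crosses _ _ [set z | val z \in S]); rewrite !inE !SubK.
move=> /(_ xS yS)[p [q []]]; rewrite !inE => pS qS pq.
(* Any edge that still leaves [S] is in the cut, so its selected endpoint was deleted. *)
have pqS : (val p, val q) \in cut S by rewrite inE pS qS.
have := imset_f sel pqS; rewrite /sel /=.
by case: ifP => _; [have := valP q | have := valP p] => /= /negP.
Qed.

(** [S] is the component of [a] after [F] is deleted: an edge leaving it must belong to [F]. *)
Lemma cut_le_separating (F : {set {set V}}) : (1 < #|V|)%N ->
    ~~ connected_graph (del_edges adj F) ->
  exists (S : {set V}) a b, [/\ a \in S, b \notin S & (#|cut S| <= #|F|)%N].
Proof.
move=> V1 /forallPn[a /forallPn[b nab]].
have [S SE] : exists S : {set V}, forall z,
    (z \in S) = connect (del_edges adj F) a z.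
  by exists [set z | connect (del_edges adj F) a z] => z; rewrite inE.
exists S, a, b; rewrite !SE connect0; split=> //.
(* Exactly one end lies in [S], so the unordered edge determines its orientation. *)
have inj : {in cut S &, injective (fun p => [set p.1; p.2])}.
  move=> [x y] [z t]; rewrite !inE /=.
  move=> /and3P[xS yS _] /and3P[zS tS _] /setP E.
  have := E x; have := E y; rewrite !inE !eqxx orbT /= => /esym yzt /esym xzt.
  have xz : x = z.
    by case/orP: xzt => /eqP // xt; rewrite -xt xS in tS.
  by case/orP: yzt => /eqP yz; [rewrite yz zS in yS | rewrite xz yz].
rewrite -(card_in_imset inj); apply: subset_leq_card.
apply/subsetP => _ /imsetP[[x y] + ->]; rewrite !inE /= => /and3P[xS yS xy].
rewrite !SE in xS yS; apply: contraNT yS => xyF; apply: connect_trans xS _.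
by apply: connect1; rewrite /del_edges xy.
Qed.

(** Whitney's inequality: a disconnecting set of edges is at least as large as some cut with
    nonempty sides, and such a cut bounds the vertex connectivity. *)
Lemma vertex_connectivity_le_edge : (1 < #|V|)%N ->
  (vertex_connectivity adj <= edge_connectivity adj)%N.
Proof.
move=> V1.
have main F : ~~ connected_graph (del_edges adj F) ->
    (vertex_connectivity adj <= #|F|)%N.
  move=> /(cut_le_separating V1)[S [a [b [aS bS]]]].
  exact/leq_trans/(vertex_connectivity_le_cut aS bS).
rewrite [edge_connectivity _]/edge_connectivity -minEnat -leEnat.
apply/bigmin_geP; split=> [|F /andP[_ Fdis]]; last exact: main.
(* The default value [#|edges adj|] is the size of the set of all edges, whose deletion disconnects
   any graph with at least two vertices. *)
apply: main; have /card_gt0P[a _] := ltnW V1.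
move: V1; rewrite (cardD1 a) add1n ltnS => /card_gt0P[b].
rewrite !inE andbT => ba; apply/negP => /forallP/(_ a)/forallP/(_ b).
move=> /(@connect_crosses _ _ [set a]); rewrite !inE eqxx => /(_ isT ba).
case=> p [q [_ _ /andP[pq /negP]]]; apply; rewrite inE.
by apply/existsP; exists p; apply/existsP; exists q; rewrite pq /=.
Qed.

End Cuts.

(** * Comparison of the energy with that of the sorted values *)

(** The square of a sum of nonnegative terms is at least the sum of their squares. This bounds an
    edge below by the path steps it spans. *)
Lemma sum_sqr_increments_le (R : realDomainType) (v : nat -> R) i j :
    (i <= j)%N -> (forall k, (i <= k < j)%N -> v k <= v k.+1) ->
  \sum_(i <= k < j) (v k.+1 - v k) ^+ 2 <= (v j - v i) ^+ 2.
Proof.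
move=> /subnKC <-; elim: (j - i)%N => [|m IH] vS.
  by rewrite addn0 big_geq // sqr_ge0.
have vi : v i <= v (i + m)%N.
  elim: m {IH} vS => [|m IH] vS; first by rewrite addn0.
  apply: (@le_trans _ _ (v (i + m)%N)).
    apply: IH => k /andP[ik km]; apply: vS.
    by rewrite ik addnS ltnS ltnW.
  by rewrite addnS; apply: vS; rewrite leq_addr !addnS !ltnS leqnSn.
rewrite addnS big_nat_recr ?leq_addr //=.
have IH' : \sum_(i <= k < i + m) (v k.+1 - v k) ^+ 2 <= (v (i + m)%N - v i) ^+ 2.
  by apply: IH => k /andP[ik km]; apply: vS; rewrite ik addnS ltnS ltnW.
apply: le_trans (lerD IH' (lexx _)) _.
have vm : v (i + m)%N <= v (i + m).+1 by apply: vS; rewrite leq_addr addnS leqnn.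
rewrite -subr_ge0.
have -> : (v (i + m).+1 - v i) ^+ 2 - ((v (i + m)%N - v i) ^+ 2 +
    (v (i + m).+1 - v (i + m)%N) ^+ 2) =
    2 * ((v (i + m)%N - v i) * (v (i + m).+1 - v (i + m)%N)) by ring.
by rewrite mulr_ge0 // mulr_ge0 // subr_ge0.
Qed.

Lemma sum_weight_cut (R : realType) (V : finType) (adj : rel V) (S : {set V}) :
  \sum_x \sum_y weight R adj x y * ((x \in S) && (y \notin S))%:R =
    #|cut adj S|%:R.
Proof.
rewrite pair_bigA -sum1_card natr_sum [RHS]big_mkcond /=; apply: eq_bigr => p _.
rewrite /weight -natrM mulnb inE andbC -andbA; by case: ifP.
Qed.

(* Sort the vertices by the value of u. An edge between positions i < j of the
   order crosses the cuts after the positions i, ..., j - 1, and each of these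
   cuts has at least edge_connectivity adj edges. *)
Lemma energy_ge_sum_sqr (R : realType) (V : finType) (adj : rel V) (u : V -> R) :
    \sum_x u x = 0 ->
  2 * (edge_connectivity adj)%:R * (1 - cos (pi / #|V|%:R)) *
    (\sum_x u x ^+ 2) * 2 <= \sum_x \sum_y weight R adj x y * (u x - u y) ^+ 2.
Proof.
move=> u0; have [V0|] := posnP #|V|.
  by rewrite !big_pred0 ?mulr0 ?mul0r // => x; have := card0_eq V0 x.
move=> /card_gt0P[x0 _]; set n := #|V|; set e := edge_connectivity adj.
pose p := sort (fun x y => u x <= u y) (enum V).
have psize : size p = n by rewrite size_sort -cardE.
have puniq : uniq p by rewrite sort_uniq enum_uniq.
have pmem x : x \in p by rewrite mem_sort mem_enum.
have psort : sorted (fun x y => u x <= u y) p.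
  by apply: sort_sorted => x y; exact: le_total.
pose v k := u (nth x0 p k); pose r x := index x p.
have rn x : (r x < n)%N by rewrite -psize index_mem.
have vr x : v (r x) = u x by rewrite /v nth_index.
have sum_p (F : V -> R) : \sum_x F x = \sum_(k < n) F (nth x0 p k).
  transitivity (\sum_(x <- p) F x).
    by rewrite -big_enum; apply/esym/perm_big; rewrite perm_sort.
  by rewrite (big_nth x0) psize big_mkord.
have vS k : (k.+1 < n)%N -> v k <= v k.+1.
  move=> kn; apply: (sorted_leq_nth _ _ _ psort) => //; rewrite ?inE ?psize //.
  - by move=> y x z; apply: le_trans.
  - exact: ltnW.
pose d k := (v k.+1 - v k) ^+ 2.
have d0 k : 0 <= d k by exact: sqr_ge0.
(* [c k x y] detects an upward crossing of the cut after position [k]; at most one of [c k x y] and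
   [c k y x] is nonzero. *)
pose c k x y : R := (r x <= k < r y)%N%:R.
have crossle x y : (r x <= r y)%N ->
    \sum_(k < n.-1) (c k x y + c k y x) * d k <= (u x - u y) ^+ 2.
  move=> xy; rewrite -sqrrN opprB -!vr.
  have yn : (r y <= n.-1)%N by rewrite -ltnS prednK // (leq_ltn_trans _ (rn x)).
  apply: le_trans (sum_sqr_increments_le xy (v := v) _); last first.
    by move=> k /andP[_ ky]; apply: vS; apply: leq_ltn_trans ky (rn y).
  rewrite (big_nat_widenl (r x) 0) // (big_nat_widen _ _ n.-1) // big_mkord.
  rewrite [leRHS]big_mkcond le_eqVlt; apply/orP; left; apply/eqP/eq_bigr => k _.
  rewrite /c; have -> : (r y <= k < r x)%N = false.
    by apply: contraTF xy => /andP[yk kx]; rewrite -ltnNge (leq_ltn_trans yk).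
  by rewrite addr0 /=; case: ifP => _; rewrite ?mul1r ?mul0r.
have cross x y : \sum_(k < n.-1) (c k x y + c k y x) * d k <= (u x - u y) ^+ 2.
  have [xy|/ltnW yx] := leqP (r x) (r y); first exact: crossle.
  rewrite -sqrrN opprB; apply: le_trans (crossle _ _ yx).
  by rewrite le_eqVlt; apply/orP; left; apply/eqP/eq_bigr => k _; rewrite addrC.
(* The two sums count the edges of the same cut in its two orientations, whence the final factor 2
   in the statement. *)
have cutle k : (k < n.-1)%N -> e%:R <= \sum_x \sum_y weight R adj x y * c k x y /\
    e%:R <= \sum_x \sum_y weight R adj x y * c k y x.
  move=> kn; have k1n : (k.+1 < n)%N by rewrite -ltn_predRL.
  have rnth i : (i < n)%N -> r (nth x0 p i) = i.
    by move=> i_n; rewrite /r index_uniq // psize.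
  pose a := nth x0 p k; pose b := nth x0 p k.+1.
  have ra : r a = k by apply/rnth/ltnW.
  have rb : r b = k.+1 by exact: rnth.
  pose S := [set x | (r x <= k)%N]; split.
    have -> : \sum_x \sum_y weight R adj x y * c k x y = #|cut adj S|%:R.
      rewrite -sum_weight_cut; apply: eq_bigr => x _; apply: eq_bigr => y _.
      by rewrite /c !inE -ltnNge.
    by rewrite ler_nat (@edge_connectivity_le_cut _ _ _ a b) // inE ?ra ?rb ?ltnn.
  have -> : \sum_x \sum_y weight R adj x y * c k y x = #|cut adj (~: S)|%:R.
    rewrite -sum_weight_cut; apply: eq_bigr => x _; apply: eq_bigr => y _.
    by rewrite /c !inE negbK -ltnNge andbC.
  by rewrite ler_nat (@edge_connectivity_le_cut _ _ _ b a) // !inE ?ra ?rb ?ltnn ?leqnn.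
have w0 x y : 0 <= weight R adj x y by exact: ler0n.
apply: (@le_trans _ _ (\sum_x \sum_y weight R adj x y *
    \sum_(k < n.-1) (c k x y + c k y x) * d k)); last first.
  by apply: ler_sum => x _; apply: ler_sum => y _; apply: ler_wpM2l.
apply: (@le_trans _ _ (2 * e%:R * \sum_(k < n.-1) d k)).
  have v0 : \sum_(k < n) v k = 0 by move: u0; rewrite sum_p.
  have := neumann_path_inequality v0; rewrite -(sum_p (fun x => u x ^+ 2)).
  have e0 : 0 <= 2 * e%:R :> R by rewrite mulr_ge0.
  move=> /(ler_wpM2l e0); apply: le_trans.
  by rewrite le_eqVlt; apply/orP; left; apply/eqP; ring.
(* Double counting: cuts crossed by each edge become edges crossing each cut. *)
have -> : \sum_x \sum_y weight R adj x y * (\sum_(k < n.-1) (c k x y + c k y x) * d k) =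
    \sum_(k < n.-1) (\sum_x \sum_y weight R adj x y * c k x y +
      \sum_x \sum_y weight R adj x y * c k y x) * d k.
  transitivity (\sum_x \sum_(k < n.-1) \sum_y
      weight R adj x y * ((c k x y + c k y x) * d k)).
    apply: eq_bigr => x _; rewrite exchange_big /=.
    by apply: eq_bigr => y _; rewrite mulr_sumr.
  rewrite exchange_big /=; apply: eq_bigr => k _.
  rewrite -big_split /= mulr_suml; apply: eq_bigr => x _.
  rewrite -big_split /= mulr_suml; apply: eq_bigr => y _; ring.
rewrite mulr_sumr; apply: ler_sum => k _; apply: ler_wpM2r => //.
have [h1 h2] := cutle k (ltn_ord k).
by rewrite mulr_natl mulr2n lerD.
Qed.

(** * The Dirichlet-to-Neumann operator *)

(** [linfun] accepts any function, so its agreement with [dtn_map] has to be derived from a proof of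
    linearity. *)
Lemma linear_lfunE (F : fieldType) (aT rT : vectType F) (f : aT -> rT) :
  linear f -> linfun f =1 f.
Proof.
move=> lf v; pose fL := GRing.isLinear.Build _ _ _ _ f lf.
pose g : {linear aT -> rT} := HB.pack f fL.
exact: (lfunE g v).
Qed.

Section Steklov.

Variables (R : realType) (V : finType) (adj : rel V) (B : {set V}).
Hypotheses (symG : symmetric adj) (connG : connected_graph adj).
Hypothesis B0 : B != set0.

Local Notation w := (weight R adj).
Local Notation lap := (@laplacian R V adj).
Local Notation bfun := (boundary_fun R B).
Local Notation ext := (@harmonic_extension R V adj B).
Local Notation dtn := (@dtn_map R V adj B).

(* Twice the polarized Dirichlet energy: each edge is counted in both directions. *)
Definition energy (u v : {ffun V -> R}) : R :=
  \sum_x \sum_y w x y * ((u x - u y) * (v x - v y)).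

Lemma sum_boundary (F : V -> R) :
  \sum_(x in B) F x = \sum_(b : boundary B) F (val b).
Proof. exact: big_sub. Qed.

Lemma weightC x y : w x y = w y x.
Proof. by rewrite /weight symG. Qed.

Lemma energyC u v : energy u v = energy v u.
Proof.
by apply: eq_bigr => x _; apply: eq_bigr => y _; rewrite [X in _ * X]mulrC.
Qed.

Lemma energy_ge0 u : 0 <= energy u u.
Proof.
apply: sumr_ge0 => x _; apply: sumr_ge0 => y _.
by rewrite mulr_ge0 ?ler0n // sqr_ge0.
Qed.

(** Summation by parts: exchanging [x] and [y] in the terms with [v y] doubles those with [v x]. *)
Lemma green_identity u v : energy u v = - 2 * \sum_x lap u x * v x.
Proof.
have -> : energy u v = \sum_x \sum_y w x y * (u x - u y) * v x +
    \sum_x \sum_y w x y * (u y - u x) * v y.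
  rewrite -big_split /=; apply: eq_bigr => x _; rewrite -big_split /=.
  by apply: eq_bigr => y _; ring.
rewrite [X in _ + X]exchange_big mulr_sumr -big_split /=; apply: eq_bigr => x _.
rewrite mulr_suml mulr_sumr -big_split /=; apply: eq_bigr => y _.
by rewrite (weightC y x); ring.
Qed.

Lemma energy_eq0_const u : energy u u = 0 -> forall x y, u x = u y.
Proof.
move=> u0; have t0 x y : 0 <= w x y * ((u x - u y) * (u x - u y)).
  by rewrite mulr_ge0 ?ler0n // sqr_ge0.
have adjE x y : adj x y -> u x = u y.
  move=> xy; move/eqP: u0; rewrite psumr_eq0 => [/allP/(_ x)|z _]; last exact: sumr_ge0.
  rewrite mem_index_enum => /(_ isT); rewrite psumr_eq0 // => /allP/(_ y).
  rewrite mem_index_enum => /(_ isT); rewrite /weight xy mul1r mulf_eq0 orbb.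
  by rewrite subr_eq0 => /eqP.
move=> x y; have /forallP/(_ x)/forallP/(_ y)/connectP[p] := connG.
elim: p x => [x _ -> //|z p IH x] /= /andP[/adjE -> zp] yz; exact: IH.
Qed.

Lemma laplacian_linear (a : R) (u v : {ffun V -> R^o}) x :
  lap (a *: u + v) x = a * lap u x + lap v x.
Proof.
rewrite /laplacian mulr_sumr -big_split /=; apply: eq_bigr => y _.
by rewrite !ffunE /GRing.scale /=; ring.
Qed.

(** By Green's identity the energy of [u] vanishes, so [u] is constant, and it is 0 on the nonempty
    set [B]. *)
Lemma harmonic_zero (u : {ffun V -> R}) :
  (forall x, x \in B -> u x = 0) -> (forall x, x \notin B -> lap u x = 0) -> u = 0.
Proof.
move=> uB uO; have E0 : energy u u = 0.
  rewrite green_identity big1 ?mulr0 // => x _.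
  by have [/uB ->|/uO ->] := boolP (x \in B); rewrite ?mulr0 ?mul0r.
have /set0Pn[b bB] := B0; apply/ffunP => x.
by rewrite (energy_eq0_const E0 x b) uB // ffunE.
Qed.

(** The Dirichlet problem is a square linear system [T u = g]. [T] is injective by [harmonic_zero],
    hence bijective. *)
Lemma harmonic_extension_exists (f : bfun) :
  exists u, is_harmonic_extension adj f u.
Proof.
pose T (u : {ffun V -> R^o}) : {ffun V -> R^o} :=
  [ffun x => if x \in B then u x else lap u x].
have linT : linear T.
  move=> a u v; apply/ffunP => x; rewrite !ffunE laplacian_linear.
  by case: ifP => _; rewrite ?ffunE.
have kerT : lker (linfun T) == 0%VS.
  apply/eqP/vspaceP => u; rewrite memv_ker memv0 linear_lfunE //.
  apply/eqP/eqP => [/ffunP Tu|->]; last first.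
    apply/ffunP => x; rewrite !ffunE /laplacian big1 ?if_same // => y _.
    by rewrite !ffunE subrr mul0r.
  apply: harmonic_zero => x xB; have := Tu x; rewrite !ffunE; first by rewrite xB.
  by rewrite (negbTE xB).
pose g : {ffun V -> R^o} := [ffun x => if insub x is Some b then f b else 0].
pose u : {ffun V -> R^o} := ((linfun T)^-1)%VF g.
have Tu : T u = g by rewrite -[T u]linear_lfunE // lker0_lfunVK.
exists u; split=> [x|x xB].
  by have /ffunP/(_ (val x)) := Tu; rewrite !ffunE (valP x) valK.
have /ffunP/(_ x) := Tu; rewrite !ffunE (negbTE xB) insubN //.
Qed.

Lemma harmonic_extensionP (f : bfun) : is_harmonic_extension adj f (ext f).
Proof. exact: classical_sets.xgetPex (harmonic_extension_exists f). Qed.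

Lemma harmonic_extension_unique (f : bfun) u :
  is_harmonic_extension adj f u -> ext f = u.
Proof.
move=> [uB uO]; have [eB eO] := harmonic_extensionP f.
apply/eqP; rewrite -subr_eq0; apply/eqP.
have lapB x : lap (ext f - u) x = lap (ext f) x - lap u x.
  rewrite /laplacian -sumrB; apply: eq_bigr => y _; rewrite !ffunE; ring.
apply: harmonic_zero => x xB; last by rewrite lapB eO // uO // subrr.
have := eB (Sub x xB); have := uB (Sub x xB); rewrite SubK !ffunE => -> ->.
exact: subrr.
Qed.

Lemma harmonic_extension_boundary (f : bfun) (b : boundary B) : ext f (val b) = f b.
Proof. by have [] := harmonic_extensionP f. Qed.

Lemma harmonic_extension_linear (a : R) (f g : bfun) :
  ext (a *: f + g) = (a *: (ext f : {ffun V -> R^o}) + ext g : {ffun V -> R^o}).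
Proof.
have [fB fO] := harmonic_extensionP f; have [gB gO] := harmonic_extensionP g.
apply: harmonic_extension_unique; split=> [b|x xB].
  by rewrite !ffunE fB gB.
by rewrite laplacian_linear fO // gO // mulr0 addr0.
Qed.

Lemma harmonic_extension_cst (c : R) : ext [ffun=> c] = [ffun=> c].
Proof.
apply: harmonic_extension_unique; split=> [b|x xB]; first by rewrite !ffunE.
by rewrite /laplacian big1 // => y _; rewrite !ffunE subrr mul0r.
Qed.

Lemma dtn_mapE (f : bfun) b : dtn f b = - lap (ext f) (val b).
Proof.
by rewrite ffunE /laplacian -sumrN; apply: eq_bigr => y _; rewrite -mulNr opprB.
Qed.

Lemma dtn_operatorE (f : bfun) : dtn_operator R adj B f = dtn f.
Proof.
apply: linear_lfunE => a g h; apply/ffunP => b.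
rewrite dtn_mapE harmonic_extension_linear laplacian_linear.
have -> : (a *: dtn g + dtn h) b = a * dtn g b + dtn h b by rewrite !ffunE.
by rewrite !dtn_mapE; ring.
Qed.

(** The Laplacian of [ext f] is [- dtn f] on [B] and vanishes elsewhere, so Green's identity keeps
    only boundary terms. *)
Lemma dtn_energy (f g : bfun) :
  2 * \sum_b dtn f b * g b = energy (ext f) (ext g).
Proof.
rewrite green_identity mulNr -mulrN -sumrN; congr (2 * _).
have [_ fO] := harmonic_extensionP f.
rewrite (bigID (mem B)) /= [X in _ + X]big1 ?addr0; last first.
  by move=> x /fO ->; rewrite mul0r oppr0.
rewrite [RHS]sum_boundary; apply: eq_bigr => b _.
by rewrite dtn_mapE harmonic_extension_boundary mulNr.
Qed.

Lemma dtn_operator_selfadjoint (f g : bfun) :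
  \sum_b dtn_operator R adj B f b * g b = \sum_b f b * dtn_operator R adj B g b.
Proof.
have two0 : 2 != 0 :> R by rewrite pnatr_eq0.
apply: (mulfI two0); rewrite !dtn_operatorE dtn_energy energyC -dtn_energy.
by congr (2 * _); apply: eq_bigr => b _; rewrite mulrC.
Qed.

Lemma dtn_kernel (f : bfun) : dtn f = 0 -> forall b c, f b = f c.
Proof.
move=> f0; have E0 : energy (ext f) (ext f) = 0.
  by rewrite -dtn_energy f0 big1 ?mulr0 // => b _; rewrite ffunE mul0r.
by move=> b c; rewrite -!harmonic_extension_boundary (energy_eq0_const E0 _ (val c)).
Qed.

(** * The eigenvalue bound *)

Lemma sum_sqr_boundary_gt0 (f : bfun) : f != 0 -> 0 < \sum_b f b ^+ 2.
Proof.
move=> f0; rewrite lt_neqAle sumr_ge0 ?andbT; last by move=> b _; rewrite sqr_ge0.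
apply: contraNneq f0 => /esym/eqP; rewrite psumr_eq0 => [|b _]; last exact: sqr_ge0.
move=> /allP fb; apply/eqP/ffunP => b; rewrite ffunE; apply/eqP.
by have := fb b (mem_index_enum b); rewrite /= sqrf_eq0.
Qed.

Lemma dtn_nonzero_eigenvalue_ge (f : bfun) a : f != 0 -> a != 0 ->
    dtn f = a *: f ->
  2 * (edge_connectivity adj)%:R * (1 - cos (pi / #|V|%:R)) <= a.
Proof.
move=> f0 a0 fa; set K := _ * _.
(* Pair [f] with the constant 1: its extension is constant, so the mutual energy vanishes. *)
have sumf : \sum_b f b = 0.
  have := dtn_energy f [ffun=> 1]; rewrite harmonic_extension_cst.
  have -> : energy (ext f) [ffun=> 1] = 0.
    by apply: big1 => x _; apply: big1 => y _; rewrite !ffunE subrr !mulr0.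
  rewrite fa => /eqP; rewrite mulf_eq0 pnatr_eq0 /= => /eqP H.
  apply: (mulfI a0); rewrite mulr0 -[RHS]H mulr_sumr; apply: eq_bigr => b _.
  by rewrite !ffunE mulr1.
have ef : energy (ext f) (ext f) = 2 * (a * \sum_b f b ^+ 2).
  rewrite -dtn_energy fa; congr (2 * _); rewrite mulr_sumr; apply: eq_bigr => b _.
  by rewrite ffunE expr2 mulrA.
have K0 : 0 <= K by rewrite !mulr_ge0 ?ler0n // subr_ge0 cos_le1.
have V0 : #|V|%:R != 0 :> R.
  by have /set0Pn[b _] := B0; rewrite pnatr_eq0 -lt0n; apply/card_gt0P; exists b.
pose m := (\sum_x ext f x) / #|V|%:R; pose v x := ext f x - m.
have sumv : \sum_x v x = 0.
  by rewrite sumrB sumr_const -[m *+ _]mulr_natr divfK // subrr.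
have := energy_ge_sum_sqr adj sumv; rewrite -/K.
have -> : \sum_x \sum_y w x y * (v x - v y) ^+ 2 = energy (ext f) (ext f).
  by apply: eq_bigr => x _; apply: eq_bigr => y _; rewrite /v; ring.
(* Drop the interior terms. On [B] the cross term vanishes by [sumf], so subtracting [m] only adds
   [m ^+ 2] at each point. *)
have sumB : \sum_b f b ^+ 2 <= \sum_x v x ^+ 2.
  rewrite [leRHS](bigID (mem B)) /= ler_wpDr //.
    by apply: sumr_ge0 => x _; exact: sqr_ge0.
  rewrite sum_boundary.
  have -> : \sum_(b : boundary B) v (val b) ^+ 2 = \sum_b (f b ^+ 2 + m ^+ 2 - 2 * m * f b).
    by apply: eq_bigr => b _; rewrite /v harmonic_extension_boundary; ring.
  rewrite sumrB -mulr_sumr sumf mulr0 subr0 big_split /= lerDl.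
  by apply: sumr_ge0 => b _; exact: sqr_ge0.
rewrite ef mulrC => H; have f2 := sum_sqr_boundary_gt0 f0.
rewrite -(ler_pM2r f2); apply: le_trans (ler_wpM2l K0 sumB) _.
by rewrite -(ler_pM2l (x := 2)) // ltr0n.
Qed.

(** The kernel consists of the constants, so 0 occurs exactly once in the spectrum. *)
Lemma dim_dtn_kernel : \dim (passmx.leigenspace (dtn_operator R adj B) 0) = 1%N.
Proof.
have -> : passmx.leigenspace (dtn_operator R adj B) 0 = <[[ffun=> 1] : bfun]>%VS.
  apply/vspaceP => f; apply/leigenspaceP/vlineP; rewrite dtn_operatorE scale0r.
    move=> /dtn_kernel fc; have /set0Pn[b bB] := B0.
    exists (f (Sub b bB)); apply/ffunP => c.
    by rewrite !ffunE /GRing.scale /= mulr1; apply: fc.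
  move=> [c ->]; apply/ffunP => b; rewrite dtn_mapE.
  have -> : c *: [ffun=> 1] = [ffun=> c] :> bfun.
    by apply/ffunP => x; rewrite !ffunE /GRing.scale /= mulr1.
  rewrite harmonic_extension_cst /laplacian big1 ?oppr0 ?ffunE // => y _.
  by rewrite !ffunE subrr mul0r.
rewrite dim_vline; have /set0Pn[b bB] := B0.
suff -> : ([ffun=> 1] : bfun) != 0 by [].
by apply/eqP => /ffunP/(_ (Sub b bB))/eqP; rewrite !ffunE oner_eq0.
Qed.

(** The indicator of one of two boundary points is not constant, so it is not in the kernel. This
    yields a nonzero eigenvalue. *)
Lemma dtn_operator_neq0 : (1 < #|B|)%N -> dtn_operator R adj B != 0.
Proof.
move=> /card_gt1P[b [c [bB cB bc]]]; apply/eqP => L0.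
pose f : bfun := [ffun x => (val x == b)%:R].
have : dtn f = 0 by rewrite -dtn_operatorE L0 lfunE.
move=> /dtn_kernel/(_ (Sub b bB) (Sub c cB))/eqP.
by rewrite !ffunE !SubK eqxx [c == b]eq_sym (negbTE bc) oner_eq0.
Qed.

Lemma steklov_spectrumP :
  is_steklov_spectrum adj B (steklov_spectrum R adj B).
Proof.
exact: classical_sets.xgetPex (eigenvalue_list_exists (dtn_operator R adj B)).
Qed.

Lemma second_steklov_eigenvalue_ge : (1 < #|B|)%N ->
  2 * (edge_connectivity adj)%:R * (1 - cos (pi / #|V|%:R)) <=
    steklov_eigenvalue R adj B 2.
Proof.
move=> B1; set K := _ * _; rewrite /steklov_eigenvalue /=.
have K0 : 0 <= K by rewrite !mulr_ge0 ?ler0n // subr_ge0 cos_le1.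
have [] := steklov_spectrumP; set s := steklov_spectrum _ _ _ => s_sorted sE.
have s0 : count_mem 0 s = 1%N by rewrite sE dim_dtn_kernel.
have memP a : reflect (exists2 f : bfun, f != 0 & dtn f = a *: f) (a \in s).
  rewrite -has_pred1 has_count sE lt0n dimv_eq0.
  apply: (iffP idP) => [L0|[f f0 fa]].
    exists (vpick (passmx.leigenspace (dtn_operator R adj B) a)).
      by rewrite vpick0.
    by rewrite -dtn_operatorE; apply/leigenspaceP/memv_pick.
  apply: contraNneq f0 => L0; rewrite -memv0 -L0; apply/leigenspaceP.
  by rewrite dtn_operatorE.
have s_ge a : a \in s -> a != 0 -> K <= a.
  by move=> /memP[f f0 fa] a0; exact: dtn_nonzero_eigenvalue_ge f0 a0 fa.
have [a a0 [f f0 fa]] := selfadjoint_nonzero_eigenvalue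
  dtn_operator_selfadjoint (dtn_operator_neq0 B1).
have as_ : a \in s by apply/memP; exists f; rewrite // -dtn_operatorE.
(* The spectrum contains 0 and the nonzero [a], so index 1 does not fall back on the default value
   of [nth]. *)
case: s => [|x [|y s]] in s_sorted s0 s_ge as_ {sE memP} *; first by [].
  move: s0 as_; rewrite /= addn0 inE => /eqP; rewrite eqb1 => /eqP -> /eqP aE.
  by rewrite aE eqxx in a0.
(* If [y] were 0, then [x] would be nonzero, as 0 occurs once, and [K <= x <= y] would still
   hold. *)
have [y0|] := eqVneq y 0; last by apply: s_ge; rewrite !inE eqxx orbT.
have xy : x <= y by move: s_sorted => /= /andP[].
have x0 : x != 0.
  by apply: contra_eqN s0 => /eqP ->; rewrite /= y0 eqxx.
have := s_ge x; rewrite inE eqxx => /(_ isT x0); rewrite y0 in xy *.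
by move=> /le_trans/(_ xy).
Qed.

End Steklov.

Theorem theorem1p2 (R : realType) (V : finType) (adj : rel V) (B : {set V})
    (simpleG : simple_graph adj) (connectedG : connected_graph adj)
    (boundaryB : graph_with_boundary adj B) (cardB : (2 <= #|B|)%N) :
  steklov_eigenvalue R adj B 2 >=
    2 * (edge_connectivity adj)%:R * (1 - cos (pi / #|V|%:R)) /\
  2 * (edge_connectivity adj)%:R * (1 - cos (pi / #|V|%:R)) >=
    2 * (vertex_connectivity adj)%:R * (1 - cos (pi / #|V|%:R)) :> R.
Proof.
have [symG _] := simpleG; have [B0 _ _] := boundaryB; split.
  exact: second_steklov_eigenvalue_ge.
have V1 : (1 < #|V|)%N by apply: leq_trans cardB (max_card _).
apply: ler_wpM2r; first by rewrite subr_ge0 cos_le1.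
by apply: ler_wpM2l => //; rewrite ler_nat vertex_connectivity_le_edge.
Qed.
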